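(* Let $w_1,w_2,w_3$ be any odd positive integers, let $n\ge 0$ be an integer and let $y_1\in\mathbb{Z}_p$. Then \begin{align*} &w_1^{n}\sum_{k=0}^{n}\binom{n}{k}T_{n-k,q^{w_1w_2}}(w_3-1)\,w_2^{n-k}w_3^{k}\sum_{i=0}^{w_1-1}(-1)^{i}q^{w_2w_3i}E_{k,q^{w_1w_3}}\Big(w_2y_1+\frac{w_2}{w_1}i\Big)\\ =&\,w_1^{n}\sum_{k=0}^{n}\binom{n}{k}T_{n-k,q^{w_1w_3}}(w_2-1)\,w_3^{n-k}w_2^{k}\sum_{i=0}^{w_1-1}(-1)^{i}q^{w_2w_3i}E_{k,q^{w_1w_2}}\Big(w_3y_1+\frac{w_3}{w_1}i\Big)\\ =&\,w_2^{n}\sum_{k=0}^{n}\binom{n}{k}T_{n-k,q^{w_1w_2}}(w_3-1)\,w_1^{n-k}w_3^{k}\sum_{i=0}^{w_2-1}(-1)^{i}q^{w_1w_3i}E_{k,q^{w_2w_3}}\Big(w_1y_1+\frac{w_1}{w_2}i\Big)\\ =&\,w_2^{n}\sum_{k=0}^{n}\binom{n}{k}T_{n-k,q^{w_2w_3}}(w_1-1)\,w_3^{n-k}w_1^{k}\sum_{i=0}^{w_2-1}(-1)^{i}q^{w_1w_3i}E_{k,q^{w_1w_2}}\Big(w_3y_1+\frac{w_3}{w_2}i\Big)\\ =&\,w_3^{n}\sum_{k=0}^{n}\binom{n}{k}T_{n-k,q^{w_1w_3}}(w_2-1)\,w_1^{n-k}w_2^{k}\sum_{i=0}^{w_3-1}(-1)^{i}q^{w_1w_2i}E_{k,q^{w_2w_3}}\Big(w_1y_1+\frac{w_1}{w_3}i\Big)\\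 =&\,w_3^{n}\sum_{k=0}^{n}\binom{n}{k}T_{n-k,q^{w_2w_3}}(w_1-1)\,w_2^{n-k}w_1^{k}\sum_{i=0}^{w_3-1}(-1)^{i}q^{w_1w_2i}E_{k,q^{w_1w_3}}\Big(w_2y_1+\frac{w_2}{w_3}i\Big). \end{align*}
   Context: Let $p$ be a fixed odd prime, $\mathbb{C}_p$ the completion of an algebraic closure of $\mathbb{Q}_p$ with absolute value normalized by $|p|_p=1/p$, and let $q\in\mathbb{C}_p$ be fixed with $|q-1|_p<p^{-1/(p-1)}$. For $r\in\mathbb{C}_p$ with $|r-1|_p<p^{-1/(p-1)}$ (in particular for $r=q^w$, $w$ a positive integer), the $r$-Euler polynomials $E_{n,r}(x)$ ($n\ge 0$) are the polynomials in $x$ defined by the generating function $$\frac{2}{re^{t}+1}e^{xt}=\sum_{n=0}^{\infty}E_{n,r}(x)\frac{t^n}{n!}.$$ For integers $k,N\ge 0$, the $r$-analogue of the alternating power sum is $T_{k,r}(N)=\sum_{i=0}^{N}(-1)^i i^k r^i$, with the convention $0^0=1$. *)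

(* Defs.v *)
From HB Require Import structures.
From mathcomp Require Import all_boot all_order all_algebra.
From mathcomp Require Import boolp classical_sets reals exp.

Set Implicit Arguments.
Unset Strict Implicit.
Unset Printing Implicit Defensive.

Import Order.TTheory GRing.Theory Num.Theory.

Local Open Scope ring_scope.

Record nonarch_abs (R : realType) (K : fieldType) (v : K -> R) : Prop := {
  nonarch_abs_ge0 : forall x, 0 <= v x;
  nonarch_abs_eq0 : forall x, v x = 0 -> x = 0;
  nonarch_abs0 : v 0 = 0;
  nonarch_absM : forall x y, v (x * y) = v x * v y;
  nonarch_absD : forall x y, v (x + y) <= Num.max (v x) (v y)
}.

Definition abs_cauchy (R : realType) (K : fieldType) (v : K -> R)
    (u : nat -> K) : Prop :=
  forall e : R, 0 < e -> exists N : nat, forall m n : nat,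
    (N <= m)%N -> (N <= n)%N -> v (u m - u n) < e.

Definition abs_converges (R : realType) (K : fieldType) (v : K -> R)
    (u : nat -> K) (l : K) : Prop :=
  forall e : R, 0 < e -> exists N : nat, forall n : nat,
    (N <= n)%N -> v (u n - l) < e.

Definition abs_complete (R : realType) (K : fieldType) (v : K -> R) : Prop :=
  forall u : nat -> K, abs_cauchy v u -> exists l : K, abs_converges v u l.

Record is_completion (R : realType) (F K : fieldType) (vF : F -> R)
    (vK : K -> R) (f : {rmorphism F -> K}) : Prop := {
  completion_abs : nonarch_abs vK;
  completion_isometry : forall x, vK (f x) = vF x;
  completion_dense : forall (y : K) (e : R), 0 < e ->
    exists x : F, vK (y - f x) < e;
  completion_complete : abs_complete vK
}.

Record is_algebraic_closure (F K : fieldType) (f : {rmorphism F -> K}) :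
    Prop := {
  algebraic_closure_closed : GRing.closed_field_axiom K;
  algebraic_closure_algebraic : forall x : K, algebraicOver f x
}.

Definition padic_abs (R : realType) (p : nat) (x : rat) : R :=
  if x == 0 then 0
  else p%:R ^ ((logn p `|denq x|)%:Z - (logn p `|numq x|)%:Z).

(* Q_p, an algebraic closure of Q_p and its completion are only determined up *)
(* to isomorphism, so C_p is given as an arbitrary tower                      *)
(*   rat -> Qp -> Qpbar -> Cp                                                 *)
(* of two completions and one algebraic closure. By is_completion, the        *)
(* absolute value of Cp restricts to padic_abs on rat, whence |p| = 1/p       *)
(* (lemma Cp_abs_prime below).                                                *)
Record padic_complex (R : realType) (p : nat) := PadicComplex {
  Qp : fieldType;
  Qp_abs : Qp -> R;
  rat_to_Qp : {rmorphism rat -> Qp};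
  Qp_completion : is_completion (padic_abs R p) Qp_abs rat_to_Qp;
  Qpbar : fieldType;
  Qpbar_abs : Qpbar -> R;
  Qp_to_Qpbar : {rmorphism Qp -> Qpbar};
  Qpbar_closure : is_algebraic_closure Qp_to_Qpbar;
  Qpbar_nonarch : nonarch_abs Qpbar_abs;
  Qpbar_abs_ext : forall x, Qpbar_abs (Qp_to_Qpbar x) = Qp_abs x;
  Cp : fieldType;
  Cp_abs : Cp -> R;
  Qpbar_to_Cp : {rmorphism Qpbar -> Cp};
  Cp_completion : is_completion Qpbar_abs Cp_abs Qpbar_to_Cp
}.

Arguments Qp_abs {R p} _ _.
Arguments Cp_abs {R p} _ _.

Definition padic_int (R : realType) (p : nat) (C : padic_complex R p) :
    set (Qp C) := [set x | Qp_abs C x <= 1]%classic.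

Arguments padic_int {R p} C _.

Definition Qp_to_Cp (R : realType) (p : nat) (C : padic_complex R p)
    (x : Qp C) : Cp C := Qpbar_to_Cp C (Qp_to_Qpbar C x).

(* A formal power series in t over A is its coefficient sequence nat -> A.    *)
Definition fps_mul (A : comUnitRingType) (f g : nat -> A) : nat -> A :=
  fun n => \sum_(i < n.+1) f i * g (n - i)%N.

(* The first n coefficients of 1/f, when f 0 is a unit.                       *)
Fixpoint fps_inv_prefix (A : comUnitRingType) (f : nat -> A) (n : nat) :
    seq A :=
  if n is m.+1 then
    let s := fps_inv_prefix f m in
    rcons s ((f 0%N)^-1 *
             ((m == 0%N)%:R - \sum_(i < m) s`_i * f (m - i)%N))
  else [::].

Definition fps_inv (A : comUnitRingType) (f : nat -> A) : nat -> A :=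
  fun n => (fps_inv_prefix f n.+1)`_n.

Definition fps_const (A : comUnitRingType) (a : A) : nat -> A :=
  fun n => if n is 0%N then a else 0.

Definition fps_add (A : comUnitRingType) (f g : nat -> A) : nat -> A :=
  fun n => f n + g n.

(* The series e^(a t).                                                        *)
Definition fps_exp (A : comUnitRingType) (a : A) : nat -> A :=
  fun n => a ^+ n / (n`!)%:R.

(* r e^t + 1, with coefficients in K[x].                                      *)
Definition euler_den (K : fieldType) (r : K) : nat -> {poly K} :=
  fps_add (fps_mul (fps_const r%:P) (fps_exp 1)) (fps_const 1).

(* 2 / (r e^t + 1) * e^(x t), where x is the polynomial variable 'X           *)
Definition euler_gf (K : fieldType) (r : K) : nat -> {poly K} :=
  fps_mul (fps_mul (fps_const 2%:R) (fps_inv (euler_den r))) (fps_exp 'X).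

Definition euler (K : fieldType) (r : K) (n : nat) : {poly K} :=
  (n`!)%:R * euler_gf r n.

Definition alt_power_sum (K : fieldType) (r : K) (k N : nat) : K :=
  \sum_(0 <= i < N.+1) (-1) ^+ i * i%:R ^+ k * r ^+ i.

Lemma Cp_abs_prime (R : realType) (p : nat) (C : padic_complex R p) :
  prime p -> Cp_abs C p%:R = p%:R^-1.
Proof.
move=> pp.
have -> : p%:R = Qp_to_Cp (rat_to_Qp C p%:R) by rewrite /Qp_to_Cp !rmorph_nat.
rewrite (completion_isometry (Cp_completion C)) Qpbar_abs_ext.
rewrite (completion_isometry (Qp_completion C)) /padic_abs.
rewrite pnatr_eq0 eqn0Ngt prime_gt0 //=.
by rewrite (denq_int p) (numq_int p) !absz_nat logn1 logn_prime // eqxx.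
Qed.

Lemma fps_mulE (A : comUnitRingType) (f g : nat -> A) m n : (n < m)%N ->
  fps_mul f g n = (\poly_(i < m) f i * \poly_(i < m) g i)`_n.
Proof.
move=> nm; rewrite coefM; apply: eq_bigr => i _; rewrite !coef_poly.
have im : (i < m)%N by apply: leq_ltn_trans nm; rewrite -ltnS.
by rewrite im (leq_ltn_trans (leq_subr _ _) nm).
Qed.

Lemma fps_mulC (A : comUnitRingType) (f g : nat -> A) :
  fps_mul f g =1 fps_mul g f.
Proof. by move=> n; rewrite !(fps_mulE _ _ (ltnSn n)) mulrC. Qed.

Lemma eq_fps_mul (A : comUnitRingType) (f f' g g' : nat -> A) :
  f =1 f' -> g =1 g' -> fps_mul f g =1 fps_mul f' g'.
Proof. by move=> ef eg n; apply: eq_bigr => i _; rewrite ef eg. Qed.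

Lemma fps_mulA (A : comUnitRingType) (f g h : nat -> A) :
  fps_mul f (fps_mul g h) =1 fps_mul (fps_mul f g) h.
Proof.
move=> n; pose P u := \poly_(i < n.+1) u i : {poly A}.
transitivity ((P f * (P g * P h))`_n).
  rewrite coefM; apply: eq_bigr => i _; rewrite coef_poly ltn_ord.
  by rewrite (@fps_mulE _ g h n.+1) // ltnS leq_subr.
rewrite mulrA coefM; apply: eq_bigr => i _; rewrite coef_poly ltnS leq_subr.
by rewrite (@fps_mulE _ f g n.+1).
Qed.

Lemma fps_mul1 (A : comUnitRingType) (f : nat -> A) :
  fps_mul (fps_const 1) f =1 f.
Proof.
move=> n; rewrite /fps_mul big_ord_recl /= mul1r subn0 big1 ?addr0 // => i _.
by rewrite mul0r.
Qed.

Lemma size_fps_inv_prefix (A : comUnitRingType) (f : nat -> A) n :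
  size (fps_inv_prefix f n) = n.
Proof. by elim: n => //= n IHn; rewrite size_rcons IHn. Qed.

Lemma fps_inv_prefixE (A : comUnitRingType) (f : nat -> A) m n : (m < n)%N ->
  (fps_inv_prefix f n)`_m = fps_inv f m.
Proof.
elim: n => // n IHn; rewrite ltnS leq_eqVlt => /predU1P[-> // | mn] /=.
by rewrite nth_rcons size_fps_inv_prefix mn IHn.
Qed.

Lemma fps_mulVr (A : comUnitRingType) (f : nat -> A) :
  f 0%N \is a GRing.unit -> fps_mul f (fps_inv f) =1 fps_const 1.
Proof.
move=> fu n; rewrite fps_mulC /fps_mul big_ord_recr /= subnn.
rewrite {2}/fps_inv /= nth_rcons size_fps_inv_prefix ltnn eqxx.
rewrite [X in _ + X]mulrC mulrA mulrV // mul1r.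
under [X in _ + (_ - X)]eq_bigr => i _ do rewrite fps_inv_prefixE //.
by rewrite addrC subrK; case: n.
Qed.

(* (r e^t + 1) * \sum_n E_{n,r}(x) t^n / n! = 2 e^(x t)                       *)
Lemma euler_gfP (K : fieldType) (r : K) :
  [pchar K] =i pred0 -> r + 1 != 0 ->
  fps_mul (euler_den r) (fun n => euler r n / (n`!)%:R)
    =1 fps_mul (fps_const 2%:R) (fps_exp 'X).
Proof.
move=> K0 r1 n.
have fact_unit m : (m`!)%:R \is a @GRing.unit {poly K}.
  by rewrite -polyC_natr rmorph_unit // unitfE (proj1 (pcharf0P K) K0) -lt0n fact_gt0.
have -> : fps_mul (euler_den r) (fun n => euler r n / (n`!)%:R) n
        = fps_mul (euler_den r) (euler_gf r) n.
  by apply: eq_fps_mul => // m; rewrite /euler mulrC mulKr.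
have den_unit : euler_den r 0%N \is a GRing.unit.
  rewrite /euler_den /fps_add /fps_mul big_ord1 /= /fps_exp fact0 divr1 mulr1.
  by rewrite -polyCD rmorph_unit // unitfE.
rewrite /euler_gf fps_mulA; apply: eq_fps_mul => // m.
rewrite fps_mulA (eq_fps_mul (fps_mulC _ _) (frefl _)) -fps_mulA.
rewrite (eq_fps_mul (frefl _) (fps_mulVr den_unit)).
by rewrite fps_mulC fps_mul1.
Qed.

Lemma Cp_pchar (R : realType) (p : nat) (C : padic_complex R p) :
  [pchar Cp C] =i pred0.
Proof.
move=> l; rewrite -(pchar_num rat l).
exact: (fmorph_pchar (Qpbar_to_Cp C \o Qp_to_Qpbar C \o rat_to_Qp C)).
Qed.

Lemma Cp_disc_neqN1 (R : realType) (p : nat) (C : padic_complex R p)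
    (r : Cp C) : prime p -> odd p ->
  Cp_abs C (r - 1) < p%:R `^ (- (p%:R - 1)^-1) -> r + 1 != 0.
Proof.
move=> pp podd hr; apply/eqP => r1.
have er : r - 1 = Qp_to_Cp (rat_to_Qp C (- 2%:R)).
  rewrite /Qp_to_Cp !rmorphN !rmorph_nat; move/eqP: r1.
  by rewrite addr_eq0 => /eqP ->; rewrite -opprD.
move: hr; rewrite er (completion_isometry (Cp_completion C)) Qpbar_abs_ext.
rewrite (completion_isometry (Qp_completion C)) /padic_abs oppr_eq0 pnatr_eq0.
rewrite denqN numqN (denq_int 2) (numq_int 2) abszN !absz_nat logn1.
have p2 : (2 < p)%N by rewrite odd_prime_gt2.
have -> : logn p 2 = 0%N by rewrite logn_prime // gtn_eqF.
rewrite subrr expr0z /=; apply/negP; rewrite -leNgt.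
have p1 : 1 <= p%:R :> R by rewrite ler1n prime_gt0.
rewrite -[leRHS](powRr0 p%:R); apply: ler_powR => //.
by rewrite oppr_le0 invr_ge0 subr_ge0.
Qed.

(* Main.v *)
Require Import Defs.
From HB Require Import structures.
From mathcomp Require Import all_boot all_order all_algebra.
From mathcomp Require Import ring.
From mathcomp Require Import boolp classical_sets reals exp.

(** By the addition theorem
      [E_{n,r}(x + z) = \sum_k 'C(n, k) E_{k,r}(x) z^(n-k)]
    and the multiplication theorem, for [b] odd,
      [E_{n,r}(b x) = b^n \sum_(l < b) (-1)^l r^l E_{n,r^b}(x + l / b)],
    each of the six expressions equals
      [(w1 w2 w3)^n \sum_(i < w1) \sum_(l < w2) \sum_(j < w3) (-1)^(i+j+l)
         q^(w2 w3 i + w1 w3 l + w1 w2 j)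
         E_{n,q^(w1 w2 w3)}(y + i / w1 + l / w2 + j / w3)],
    which is symmetric in [w1, w2, w3]. The multiplication theorem holds because
    [E_{n,r}] is the only polynomial [P] with [r P(x + 1) + P(x) = 2 x^n]. *)

Import Order.TTheory GRing.Theory Num.Theory.

Local Open Scope ring_scope.

(** * Inverses of power series under ring morphisms *)

Lemma fps_inv_prefix_rmorph (A B : comUnitRingType) (phi : {rmorphism A -> B})
    (f : nat -> A) (m : nat) : f 0%N \is a GRing.unit ->
  fps_inv_prefix (phi \o f) m = map phi (fps_inv_prefix f m).
Proof.
move=> fu; elim: m => //= m IHm; rewrite map_rcons IHm; congr rcons.
rewrite rmorphM rmorphV // rmorphB rmorph_nat rmorph_sum; congr (_ * (_ - _)).
apply: eq_bigr => i _.
by rewrite rmorphM (nth_map 0) // size_fps_inv_prefix.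
Qed.

Lemma fps_inv_rmorph (A B : comUnitRingType) (phi : {rmorphism A -> B})
    (f : nat -> A) : f 0%N \is a GRing.unit ->
  fps_inv (phi \o f) =1 phi \o fps_inv f.
Proof.
move=> fu m; rewrite /fps_inv fps_inv_prefix_rmorph // (nth_map 0) //.
by rewrite size_fps_inv_prefix.
Qed.

Lemma eq_fps_inv (A : comUnitRingType) (f g : nat -> A) :
  f =1 g -> fps_inv f =1 fps_inv g.
Proof. by move=> /funext ->. Qed.

(** * Generating functions, the addition theorem and the difference equation *)

Section EulerPolynomials.

Variable K : fieldType.
Hypothesis K0 : [pchar K] =i pred0.
Implicit Types (r x z : K) (n k m : nat).

Let natr_neq0 m : (0 < m)%N -> m%:R != 0 :> K.
Proof. by rewrite (proj1 (pcharf0P K) K0) lt0n. Qed.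

Let fact_neq0 m : (m`!)%:R != 0 :> K.
Proof. exact/natr_neq0/fact_gt0. Qed.

(** Products of exponential generating functions are binomial convolutions, since
    [n! = 'C(n, k) k! (n - k)!]. *)
Lemma fact_fps_mul (f g : nat -> K) n :
  (n`!)%:R * fps_mul f g n =
  \sum_(k < n.+1) 'C(n, k)%:R * ((k`!)%:R * f k) * (((n - k)`!)%:R * g (n - k)%N).
Proof.
rewrite /fps_mul mulr_sumr; apply: eq_bigr => k _.
have kn : (k <= n)%N by rewrite -ltnS.
by rewrite -(bin_fact kn) !natrM; ring.
Qed.

Lemma fact_fps_exp x n : (n`!)%:R * fps_exp x n = x ^+ n.
Proof. by rewrite /fps_exp mulrC divfK. Qed.

Lemma fps_expD x z : fps_mul (fps_exp x) (fps_exp z) =1 fps_exp (x + z).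
Proof.
move=> n; apply: (mulfI (fact_neq0 n)).
rewrite fact_fps_mul fact_fps_exp addrC exprDn; apply: eq_bigr => k _.
by rewrite !fact_fps_exp -mulr_natr; ring.
Qed.

(** The series [2 / (r e^t + 1)] over [K] itself, that is, the exponential generating function of
    the numbers [E_{n,r}(0)]. *)
Definition euler_number_gf r : nat -> K :=
  fps_mul (fps_const 2%:R)
    (fps_inv (fps_add (fps_mul (fps_const r) (fps_exp 1)) (fps_const 1))).

(** The denominator [r e^t + 1] has constant polynomials as coefficients, so its inverse over [K[x]]
    is the image under [polyC] of its inverse over [K]; evaluation only affects the factor
    [e^('X t)]. *)
Lemma euler_horner r n x : r + 1 != 0 ->
  (euler r n).[x] = (n`!)%:R * fps_mul (euler_number_gf r) (fps_exp x) n.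
Proof.
move=> r1; rewrite /euler /euler_gf hornerM hornerMn hornerC; congr (_ * _).
set D := fps_add (fps_mul (fps_const r) (fps_exp 1)) (fps_const 1).
have cE (a : K) m : fps_const a%:P m = (fps_const a m)%:P by case: m.
have Du : D 0%N \is a GRing.unit.
  by rewrite /D /fps_add /fps_mul big_ord1 /= /fps_exp fact0 divr1 mulr1 unitfE.
have facV m : (m`!)%:R^-1 = (((m`!)%:R)^-1)%:P :> {poly K}.
  by rewrite -polyC_natr polyCV.
have DE : euler_den r =1 polyC \o D.
  move=> m; rewrite /euler_den /D /fps_add /= polyCD -cE polyC1.
  congr (_ + _); rewrite /fps_mul rmorph_sum; apply: eq_bigr => i _ /=.
  by rewrite cE polyCM /fps_exp !expr1n !div1r facV.
have gE : fps_mul (fps_const 2%:R) (fps_inv (euler_den r))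
          =1 polyC \o euler_number_gf r.
  move=> m; rewrite (eq_fps_mul (frefl _) (eq_fps_inv _ _ _ DE)).
  rewrite /= /fps_mul rmorph_sum; apply: eq_bigr => i _ /=.
  by rewrite polyCM -cE polyC_natr fps_inv_rmorph.
rewrite (eq_fps_mul gE (frefl _)) /fps_mul horner_sum; apply: eq_bigr => i _.
by rewrite hornerM hornerC /fps_exp facV hornerM hornerC hornerXn.
Qed.

Lemma euler_addition r n x z : r + 1 != 0 ->
  (euler r n).[x + z] =
  \sum_(k < n.+1) 'C(n, k)%:R * (euler r k).[x] * z ^+ (n - k).
Proof.
move=> r1; rewrite euler_horner //.
rewrite -(eq_fps_mul (frefl _) (fps_expD x z)) fps_mulA fact_fps_mul.
by apply: eq_bigr => k _; rewrite fact_fps_exp -euler_horner.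
Qed.

(** On [e^(x t)] the operator on the left acts as multiplication by [r e^t + 1], which cancels the
    denominator of the generating function. *)
Lemma euler_difference r n x : r + 1 != 0 ->
  r * (euler r n).[x + 1] + (euler r n).[x] = 2 * x ^+ n.
Proof.
move=> r1.
set D := fps_add (fps_mul (fps_const r) (fps_exp 1)) (fps_const 1).
have Du : D 0%N \is a GRing.unit.
  by rewrite /D /fps_add /fps_mul big_ord1 /= /fps_exp fact0 divr1 mulr1 unitfE.
have cM (a : K) (f : nat -> K) m : fps_mul (fps_const a) f m = a * f m.
  rewrite /fps_mul big_ord_recl /= subn0 big1 ?addr0 // => i _.
  by rewrite mul0r.
have De : fps_mul D (fps_exp x) =1 fun m => r * fps_exp (x + 1) m + fps_exp x m.
  move=> m; rewrite -[in RHS](fps_mul1 (fps_exp x) m) -cM.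
  rewrite [x + 1]addrC -(eq_fps_mul (frefl _) (fps_expD 1 x)) fps_mulA.
  by rewrite /fps_mul -big_split; apply: eq_bigr => i _; rewrite /= -mulrDl.
have -> : r * (euler r n).[x + 1] + (euler r n).[x] =
    (n`!)%:R * fps_mul (euler_number_gf r)
                 (fun m => r * fps_exp (x + 1) m + fps_exp x m) n.
  rewrite !euler_horner // mulrCA -mulrDr; congr (_ * _).
  rewrite /fps_mul mulr_sumr -big_split; apply: eq_bigr => i _ /=.
  by ring.
rewrite -(eq_fps_mul (frefl _) De) fps_mulA /euler_number_gf -/D.
rewrite (eq_fps_mul _ (frefl _) (g' := fps_exp x) (f' := fps_const 2)).
  by rewrite cM mulrCA fact_fps_exp.
move=> m; rewrite -fps_mulA (eq_fps_mul (frefl _) (fps_mulC _ _)).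
by rewrite (eq_fps_mul (frefl _) (fps_mulVr Du)) fps_mulC fps_mul1.
Qed.

(** * Uniqueness for the difference equation, and the multiplication theorem *)

Lemma poly_eq_natr (P Q : {poly K}) :
  (forall m, P.[m%:R] = Q.[m%:R]) -> P = Q.
Proof.
move=> PQ; apply/eqP; rewrite -subr_eq0; apply/eqP/(roots_geq_poly_eq0
  (rs := [seq m%:R | m <- iota 0 (size (P - Q))])).
- by apply/allP => _ /mapP[m _ ->]; rewrite /root hornerD hornerN PQ subrr.
- rewrite map_inj_uniq ?iota_uniq // => a b /eqP ab; apply/eqP; move: ab.
  wlog le_ab : a b / (a <= b)%N.
    move=> IH; case: (leqP a b) => [|/ltnW] ab; first exact: IH.
    by rewrite eq_sym [a == b]eq_sym; apply: IH.
  rewrite eq_sym -subr_eq0 -natrB // (proj1 (pcharf0P K) K0) subn_eq0 => ba.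
  by rewrite eqn_leq le_ab.
- by rewrite size_map size_iota.
Qed.

(* Since [r != -1], the operator [P |-> r P(x + 1) + P(x)] multiplies the
   leading coefficient by [r + 1], hence is injective. *)
Lemma difference_inj r (P Q : {poly K}) : r + 1 != 0 ->
  (forall x, r * P.[x + 1] + P.[x] = r * Q.[x + 1] + Q.[x]) -> P = Q.
Proof.
move=> r1 PQ; apply/eqP; rewrite -subr_eq0; set D := P - Q.
have D0 : r *: (D \Po ('X + 1%:P)) + D = 0.
  apply: poly_eq_natr => m; move/eqP: (PQ m%:R).
  rewrite -subr_eq0 => /eqP e.
  rewrite horner0 hornerD hornerZ horner_comp /D !hornerD !hornerN hornerX.
  by rewrite hornerC -[RHS]e; ring.
have: lead_coef (D \Po ('X + 1%:P)) = lead_coef D.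
  rewrite lead_coef_comp ?size_XaddC // lead_coefXaddC expr1n mulr1 //.
have sD : size (D \Po ('X + 1%:P)) = size D by rewrite size_comp_poly2 ?size_XaddC.
rewrite /lead_coef sD => lcE.
rewrite -lead_coef_eq0 -(mulrI_eq0 _ (mulfI r1)) mulrDl mul1r /lead_coef -{1}lcE.
by rewrite -coefZ -coefD D0 coef0.
Qed.

Lemma euler_multiplication r n b x : odd b -> r + 1 != 0 -> r ^+ b + 1 != 0 ->
  (euler r n).[b%:R * x] =
  b%:R ^+ n * \sum_(0 <= l < b)
    (-1) ^+ l * r ^+ l * (euler (r ^+ b) n).[x + l%:R / b%:R].
Proof.
move=> bo r1 rb1.
have b0 : b%:R != 0 :> K by apply: natr_neq0; case: b bo {rb1}.
(* The right-hand side as a polynomial in [z = b x]; it remains to check its difference equation. *)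
pose P := b%:R ^+ n *: \sum_(0 <= l < b) ((-1) ^+ l * r ^+ l) *:
   (euler (r ^+ b) n \Po (b%:R^-1 *: 'X + (l%:R / b%:R)%:P)).
have PE z : P.[z] = b%:R ^+ n * \sum_(0 <= l < b)
    (-1) ^+ l * r ^+ l * (euler (r ^+ b) n).[z / b%:R + l%:R / b%:R].
  rewrite /P hornerZ horner_sum; congr (_ * _); apply: eq_bigr => l _.
  by rewrite hornerZ horner_comp !hornerE [_^-1 * z]mulrC.
suff -> : euler r n = P by rewrite PE [b%:R * x]mulrC mulfK.
apply: (difference_inj r) => // z; rewrite euler_difference // !PE.
rewrite mulrCA -mulrDr mulr_sumr.
(* Replacing [z] by [z + 1] shifts [l] to [l + 1], and the extra factor [r] matches up to sign, so
   the sum telescopes to [h 0 - h b]. *)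
pose h l := (-1) ^+ l * r ^+ l * (euler (r ^+ b) n).[z / b%:R + l%:R / b%:R].
have -> : \sum_(0 <= l < b) r * ((-1) ^+ l * r ^+ l *
            (euler (r ^+ b) n).[(z + 1) / b%:R + l%:R / b%:R])
        = \sum_(0 <= l < b) - h l.+1.
  apply: eq_bigr => l _; rewrite /h !exprS -natr1 !mulrDl mul1r.
  rewrite [_ + b%:R^-1 + _]addrAC addrA; by ring.
rewrite -big_split /=.
under eq_bigr do rewrite addrC -opprB.
rewrite sumrN telescope_sumr // opprB /h !expr0 mul0r addr0 !mul1r.
(* As [b] is odd, [- h b] is [r^b E_{n,r^b}(z / b + 1)], and the difference equation for [r^b] at
   [z / b] applies. *)
rewrite -signr_odd bo expr1 divff // mulN1r mulNr opprK.
by rewrite addrC euler_difference // mulrCA -exprMn [b%:R * _]mulrC divfK.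
Qed.

(** * The symmetric triple sum *)

Definition euler_triple_sum (q y : K) (n a b c : nat) : K :=
  (a%:R * b%:R * c%:R) ^+ n *
  \sum_(0 <= i < a) \sum_(0 <= l < b) \sum_(0 <= j < c)
    (-1) ^+ (i + l + j) * q ^+ (b * c * i + a * c * l + a * b * j) *
    (euler (q ^+ (a * b * c)) n).[y + i%:R / a%:R + l%:R / b%:R + j%:R / c%:R].

Lemma euler_triple_sumC23 q y n a b c :
  euler_triple_sum q y n a b c = euler_triple_sum q y n a c b.
Proof.
rewrite /euler_triple_sum [a%:R * b%:R * c%:R]mulrAC (mulnAC a b c).
congr (_ * _); apply: eq_bigr => i _; rewrite exchange_big.
apply: eq_bigr => l _; apply: eq_bigr => j _.
rewrite [(i + _ + _)%N]addnAC [(_ * i + _ + _)%N]addnAC (mulnC b c).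
by rewrite [_ + j%:R / _ + _]addrAC.
Qed.

Lemma euler_triple_sumC12 q y n a b c :
  euler_triple_sum q y n a b c = euler_triple_sum q y n b a c.
Proof.
rewrite /euler_triple_sum [a%:R * b%:R]mulrC (mulnC a b).
congr (_ * _); rewrite exchange_big.
apply: eq_bigr => l _; apply: eq_bigr => i _; apply: eq_bigr => j _.
by rewrite (addnC i) (addnC (b * c * i)%N) [_ + i%:R / _ + _]addrAC.
Qed.

(** Writing out the alternating power sum introduces [j]; the addition theorem then absorbs the sum
    over [k] as a shift by [b j / c], and the multiplication theorem with factor [b] produces the
    sum over [l]. *)
Lemma euler_triple_sumE q y n a b c : odd a -> odd b -> odd c ->
  q ^+ (a * c) + 1 != 0 -> q ^+ (a * b * c) + 1 != 0 ->
  a%:R ^+ n * \sum_(0 <= k < n.+1) 'C(n, k)%:R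
      * alt_power_sum (q ^+ (a * b)) (n - k) (c - 1)
      * b%:R ^+ (n - k) * c%:R ^+ k
      * \sum_(0 <= i < a) (-1) ^+ i * q ^+ (b * c * i)
          * (euler (q ^+ (a * c)) k).[b%:R * y + b%:R / a%:R * i%:R]
  = euler_triple_sum q y n a b c.
Proof.
move=> ao bo co r1 rb1.
have a0 : a%:R != 0 :> K by apply: natr_neq0; case: a ao {r1 rb1}.
have c0 : c%:R != 0 :> K by apply: natr_neq0; case: c co {r1 rb1}.
have rb1' : (q ^+ (a * c)) ^+ b + 1 != 0 by rewrite -exprM mulnAC.
(* The intermediate form has the sum over [k] collapsed and the multiplication theorem not yet
   applied. *)
transitivity ((a%:R * c%:R) ^+ n * \sum_(0 <= i < a) \sum_(0 <= j < c)
    (-1) ^+ (i + j) * q ^+ (b * c * i + a * b * j) *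
    (euler (q ^+ (a * c)) n).[b%:R * (y + i%:R / a%:R + j%:R / c%:R)]); last first.
  rewrite /euler_triple_sum [a%:R * b%:R * c%:R]mulrAC [_ ^+ n in RHS]exprMn.
  rewrite -mulrA; congr (_ * _); rewrite mulr_sumr; apply: eq_bigr => i _.
  rewrite exchange_big mulr_sumr; apply: eq_bigr => j _.
  rewrite euler_multiplication // mulrCA !mulr_sumr; apply: eq_bigr => l _.
  rewrite -!exprM (mulnAC a c b) [_ + l%:R / _ + _]addrAC !exprD.
  by ring.
rewrite exprMn -mulrA; congr (_ * _).
(* [alt_power_sum] includes its upper bound, so [c - 1] gives exactly [c] terms; [c > 0] rules out
   truncated subtraction. *)
have cS : (c - 1).+1 = c by rewrite subn1 prednK // odd_gt0.
transitivity (\sum_(0 <= k < n.+1) \sum_(0 <= i < a) \sum_(0 <= j < c)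
   (-1) ^+ (i + j) * q ^+ (b * c * i + a * b * j) * ('C(n, k)%:R * c%:R ^+ k *
    (j%:R * b%:R) ^+ (n - k) *
    (euler (q ^+ (a * c)) k).[b%:R * y + b%:R / a%:R * i%:R])).
  apply: eq_bigr => k _; rewrite mulr_sumr; apply: eq_bigr => i _.
  rewrite /alt_power_sum cS mulr_sumr !mulr_suml; apply: eq_bigr => j _.
  rewrite -exprM !exprD exprMn; by ring.
rewrite exchange_big mulr_sumr; apply: eq_bigr => i _.
rewrite exchange_big mulr_sumr; apply: eq_bigr => j _.
rewrite mulrCA -mulr_sumr; congr (_ * _).
have -> : b%:R * (y + i%:R / a%:R + j%:R / c%:R) =
   (b%:R * y + b%:R / a%:R * i%:R) + j%:R * b%:R / c%:R by ring.
rewrite euler_addition // big_mkord mulr_sumr; apply: eq_bigr => k _.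
have kn : (k <= n)%N by rewrite -ltnS.
have -> : c%:R ^+ n = c%:R ^+ k * c%:R ^+ (n - k) :> K by rewrite -exprD subnKC.
rewrite expr_div_n.
have ck0 : c%:R ^+ (n - k) != 0 :> K by rewrite expf_neq0.
by field.
Qed.

End EulerPolynomials.

(** * Powers of [q] in the disc around 1, and the six expressions *)

Lemma nonarch_abs1 (R : realType) (K : fieldType) (v : K -> R) :
  nonarch_abs v -> v 1 = 1.
Proof.
move=> hv; have v1 : v 1 != 0.
  by apply/eqP => /(nonarch_abs_eq0 hv) /eqP; rewrite oner_eq0.
by apply: (mulfI v1); rewrite -(nonarch_absM hv) !mulr1.
Qed.

(** Induction on [q^(m+1) - 1 = q (q^m - 1) + (q - 1)], using the ultrametric inequality and
    [v q <= 1]. *)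
Lemma nonarch_absX_sub1 (R : realType) (K : fieldType) (v : K -> R) (q : K) m :
  nonarch_abs v -> v (q - 1) <= 1 -> v (q ^+ m - 1) <= v (q - 1).
Proof.
move=> hv q1; have vq : v q <= 1.
  rewrite -[q](subrK 1) (le_trans (nonarch_absD hv _ _)) //.
  by rewrite ge_max q1 (nonarch_abs1 _ _ _ hv) lexx.
elim: m => [|m IHm]; first by rewrite subrr (nonarch_abs0 hv) (nonarch_abs_ge0 hv).
have -> : q ^+ m.+1 - 1 = q * (q ^+ m - 1) + (q - 1) by rewrite exprS; ring.
rewrite (le_trans (nonarch_absD hv _ _)) // ge_max lexx andbT (nonarch_absM hv).
by rewrite (le_trans _ IHm) // ler_piMl // (nonarch_abs_ge0 hv).
Qed.

Theorem theorem4p11 (R : realType) (p : nat) (p_prime : prime p)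
    (p_odd : odd p) (C : padic_complex R p) (q : Cp C)
    (hq : Cp_abs C (q - 1) < p%:R `^ (- (p%:R - 1)^-1))
    (w1 w2 w3 : nat) (w1_odd : odd w1) (w2_odd : odd w2) (w3_odd : odd w3)
    (n : nat) (y1 : Qp C) (hy1 : padic_int C y1) :
  let y := Qp_to_Cp y1 in
  let T := fun (k : nat) (r : Cp C) (N : nat) => alt_power_sum r k N in
  let E := fun (k : nat) (r x : Cp C) => (euler r k).[x] in
  let S1 :=
    w1%:R ^+ n * \sum_(0 <= k < n.+1) 'C(n, k)%:R
      * T (n - k)%N (q ^+ (w1 * w2)) (w3 - 1)%N
      * w2%:R ^+ (n - k) * w3%:R ^+ k
      * \sum_(0 <= i < w1) (-1) ^+ i * q ^+ (w2 * w3 * i)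
          * E k (q ^+ (w1 * w3)) (w2%:R * y + w2%:R / w1%:R * i%:R) in
  let S2 :=
    w1%:R ^+ n * \sum_(0 <= k < n.+1) 'C(n, k)%:R
      * T (n - k)%N (q ^+ (w1 * w3)) (w2 - 1)%N
      * w3%:R ^+ (n - k) * w2%:R ^+ k
      * \sum_(0 <= i < w1) (-1) ^+ i * q ^+ (w2 * w3 * i)
          * E k (q ^+ (w1 * w2)) (w3%:R * y + w3%:R / w1%:R * i%:R) in
  let S3 :=
    w2%:R ^+ n * \sum_(0 <= k < n.+1) 'C(n, k)%:R
      * T (n - k)%N (q ^+ (w1 * w2)) (w3 - 1)%N
      * w1%:R ^+ (n - k) * w3%:R ^+ k
      * \sum_(0 <= i < w2) (-1) ^+ i * q ^+ (w1 * w3 * i)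
          * E k (q ^+ (w2 * w3)) (w1%:R * y + w1%:R / w2%:R * i%:R) in
  let S4 :=
    w2%:R ^+ n * \sum_(0 <= k < n.+1) 'C(n, k)%:R
      * T (n - k)%N (q ^+ (w2 * w3)) (w1 - 1)%N
      * w3%:R ^+ (n - k) * w1%:R ^+ k
      * \sum_(0 <= i < w2) (-1) ^+ i * q ^+ (w1 * w3 * i)
          * E k (q ^+ (w1 * w2)) (w3%:R * y + w3%:R / w2%:R * i%:R) in
  let S5 :=
    w3%:R ^+ n * \sum_(0 <= k < n.+1) 'C(n, k)%:R
      * T (n - k)%N (q ^+ (w1 * w3)) (w2 - 1)%N
      * w1%:R ^+ (n - k) * w2%:R ^+ k
      * \sum_(0 <= i < w3) (-1) ^+ i * q ^+ (w1 * w2 * i)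
          * E k (q ^+ (w2 * w3)) (w1%:R * y + w1%:R / w3%:R * i%:R) in
  let S6 :=
    w3%:R ^+ n * \sum_(0 <= k < n.+1) 'C(n, k)%:R
      * T (n - k)%N (q ^+ (w2 * w3)) (w1 - 1)%N
      * w2%:R ^+ (n - k) * w1%:R ^+ k
      * \sum_(0 <= i < w3) (-1) ^+ i * q ^+ (w1 * w2 * i)
          * E k (q ^+ (w1 * w3)) (w2%:R * y + w2%:R / w3%:R * i%:R) in
  [/\ S1 = S2, S2 = S3, S3 = S4, S4 = S5 & S5 = S6].
Proof.
(* All powers of [q] stay in the disc around 1, whose radius is at most 1; for odd [p] it does not
   contain -1. *)
have hqm m : q ^+ m + 1 != 0.
  apply: (Cp_disc_neqN1 (p := p)) => //; apply: le_lt_trans (hq).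
  apply: (nonarch_absX_sub1 _ _ _ _ _ (completion_abs (Cp_completion C))).
  apply: le_trans (ltW hq) _.
  have p1 : 1 <= p%:R :> R by rewrite ler1n prime_gt0.
  rewrite -[leRHS](powRr0 p%:R); apply: ler_powR => //.
  by rewrite oppr_le0 invr_ge0 subr_ge0.
move=> y T E S1 S2 S3 S4 S5 S6.
have K0 := Cp_pchar C.
pose U := euler_triple_sum (Cp C) q y n.
(* In each expression [a] is the length of the inner sum, [b] carries the power [n - k], and [c] is
   the length of the alternating power sum. *)
have e1 : S1 = U w1 w2 w3 by apply: euler_triple_sumE.
have e2 : S2 = U w1 w3 w2.
  by rewrite /S2 (mulnC w2 w3); apply: euler_triple_sumE.
have e3 : S3 = U w2 w1 w3.
  by rewrite /S3 (mulnC w1 w2); apply: euler_triple_sumE.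
have e4 : S4 = U w2 w3 w1.
  by rewrite /S4 (mulnC w1 w2) (mulnC w1 w3); apply: euler_triple_sumE.
have e5 : S5 = U w3 w1 w2.
  by rewrite /S5 (mulnC w1 w3) (mulnC w2 w3); apply: euler_triple_sumE.
have e6 : S6 = U w3 w2 w1.
  by rewrite /S6 (mulnC w1 w2) (mulnC w2 w3) (mulnC w1 w3); apply: euler_triple_sumE.
(* These two transpositions generate all permutations of the three weights. *)
have s12 a b c : U a b c = U b a c by apply: euler_triple_sumC12.
have s23 a b c : U a b c = U a c b by apply: euler_triple_sumC23.
rewrite e1 e2 e3 e4 e5 e6; split.
- exact: s23.
- by rewrite s23 s12.
- exact: s23.
- by rewrite s12 s23.
- exact: s23.
Qed.
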